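(* Let $A\in\mathbb{R}^{n\times n}$ and $B\in\mathbb{R}^{n\times q}$. Let $\lambda_1,\dots,\lambda_m$ be the distinct eigenvalues of $A$, with algebraic multiplicities $n_1,\dots,n_m$ ($n_1+\dots+n_m=n$), and suppose $\lambda_i+\lambda_j\neq0$ for all $i,j\in\{1,\dots,m\}$. Let $P(\infty)$ be the solution of $AP+PA^T=-BB^T$ and let $P(t)$ be the solution of $$-\frac{dP(t)}{dt}+AP(t)+P(t)A^T=-BB^T,\qquad P(0)=0 .$$ Then $$P(\infty)=\sum_{i=1}^m\sum_{k=1}^{n_i}\hat A_k^{(i)}\,BB^T\,(-\lambda_iI-A^T)^{-k},$$ $$P(t)=\sum_{i=1}^m\sum_{k=1}^{n_i}\hat A_k^{(i)}\,BB^T\left[(-\lambda_iI-A^T)^{-k}-\sum_{l=1}^k(-\lambda_iI-A^T)^{-l}\frac{t^{k-l}}{(k-l)!}\,e^{(\lambda_iI+A^T)t}\right],$$ where $$\hat A_k^{(i)}=\frac{1}{(n_i-k)!}\cdot\frac{d^{\,n_i-k}}{d\lambda^{\,n_i-k}}\left[(\lambda-\lambda_i)^{n_i}(\lambda I-A)^{-1}\right]_{\lambda=\lambda_i}$$ are the matrix coefficients in the partial fraction decomposition of the resolvent, $(\lambda I-A)^{-1}=\sum_{i=1}^m\sum_{k=1}^{n_i}\hat A_k^{(i)}(\lambda-\lambda_i)^{-k}$.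
   Context: The function $(\lambda-\lambda_i)^{n_i}(\lambda I-A)^{-1}$ is understood as its analytic continuation to $\lambda=\lambda_i$. $A$ is not assumed diagonalizable or stable; the notation $P(\infty)$ simply denotes the (unique) solution of the algebraic Lyapunov equation. *)

(* Defs.v *)
(* The complex numbers are R[i] over R : realType, with the topology that every
   numFieldType carries. *)
From HB Require Import structures.
From mathcomp Require Export all_boot all_order all_algebra.
From mathcomp Require Export complex.
From mathcomp Require Export all_classical all_reals all_analysis.

Set Implicit Arguments.
Unset Strict Implicit.
Unset Printing Implicit Defensive.

Export Order.TTheory GRing.Theory Num.Theory.
Export numFieldNormedType.Exports.

Local Open Scope classical_set_scope.
Local Open Scope ring_scope.

Definition complex_mx (R : realType) (m n : nat) (M : 'M[R]_(m, n)) :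
  'M[R[i]]_(m, n) := map_mx (real_complex R) M.

(* Negative powers are powers of invmx, since 'M_n has a unit ring structure
   only when n is a successor. *)
Definition mx_negpow (F : fieldType) (n : nat) (M : 'M[F]_n) (k : nat) :
  'M[F]_n := invmx M ^+ k.

Definition expmx (K : numFieldType) (n : nat) (M : 'M[K]_n) : 'M[K]_n :=
  limn (series (fun k => (k`!%:R)^-1 *: M ^+ k)).

(* At an eigenvalue of A, invmx returns a junk value; in what follows only the
   values at the other points matter. *)
Definition resolvent (F : fieldType) (n : nat) (A : 'M[F]_n) (z : F) : 'M[F]_n :=
  invmx (z%:M - A).

(* Here and below K is used at R[i], where derivable is complex
   differentiability, so that g is holomorphic near a. *)
Definition is_analytic_continuation (K : numFieldType) (n : nat)
    (f : K -> 'M[K]_n) (a : K) (g : K -> 'M[K]_n) : Prop :=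
  (\forall z \near a, derivable g z 1) /\ (\forall z \near a^', g z = f z).

(* Any two continuations of f at a coincide near a, so the derivatives at a of
   the chosen one do not depend on the choice. *)
Definition analytic_continuation (K : numFieldType) (n : nat)
    (f : K -> 'M[K]_n) (a : K) : K -> 'M[K]_n :=
  xget f [set g | is_analytic_continuation f a g].

Definition resolvent_coef (K : numFieldType) (n : nat) (A : 'M[K]_n)
    (a : K) (na k : nat) : 'M[K]_n :=
  ((na - k)`!%:R)^-1 *:
    derive1n (na - k)
      (analytic_continuation (fun z => (z - a) ^+ na *: resolvent A z) a) a.

(* Main.v *)
Require Import Defs.
From mathcomp Require Import ring zify.

(** Write [C] for the complexification of [A], [Q] for [B B^T].

    Evaluating a Bezout relation between the factors [(X - lambda i) ^+ mult i] of
    the characteristic polynomial at [C] gives the spectral projections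
    ([coprime_splitting]); multiplying them by the powers of [C - lambda i] gives
    matrices [H i k] with [sum_i H i 1 = 1],
    [C H i k = lambda i H i k + H i (k+1)] and [H i (mult i + 1) = 0]
    ([laurent_chain_exists]). These relations carry the whole proof.

    They make [sum_(i, k) (z - lambda i)^-k H i k] an inverse of [z - C], by
    telescoping ([resolvent_chain]). Near an eigenvalue the analytic continuation
    of [(z - lambda i)^(mult i) (z - C)^-1] is therefore an explicit function, whose
    Taylor coefficients are the [H i k] ([resolvent_coef_chain]): the coefficients
    of the theorem are the [H i k].

    Since [(- lambda i - C^T)^-k C^T] is
    [- lambda i (- lambda i - C^T)^-k - (- lambda i - C^T)^-(k-1)], the same
    telescoping shows that [S = sum_(i, k) H i k Q (- lambda i - C^T)^-k] solves the
    algebraic equation ([lyapunov_chain]). That equation has one solution, because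
    [C] and [- C^T] have no common eigenvalue ([sylvester_uniq]); so [Pinf = S].

    For the differential equation, the terms with exponentials form a function
    [G] that solves the homogeneous equation [G' = C G + G C^T] with [G 0 = S]
    ([transient_derive], [transient0]); this is once more a telescoping sum, now
    between [H i (k+1)] and the derivative of [t^(k-l) / (k-l)!]. Then
    [P - S + G] solves the homogeneous equation and vanishes at 0, so it is zero
    ([sylvester_ode_uniq]). Differentiating the matrix exponential, defined as a
    limit over [R[i]], is reduced to real power series in the real and imaginary
    parts of the entries ([mx_derive_expmx]). *)

Set Implicit Arguments.
Unset Strict Implicit.
Unset Printing Implicit Defensive.

Local Open Scope classical_set_scope.
Local Open Scope ring_scope.
Local Open Scope complex_scope.

Local Notation re := (@complex.Re _).
Local Notation im := (@complex.Im _).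

(** * Pairwise coprime polynomials and the characteristic polynomial *)

Lemma coprimep_bigprod (F : fieldType) (I : eqType) (p : I -> {poly F})
    (q : {poly F}) (s : seq I) :
  {in s, forall i, coprimep q (p i)} -> coprimep q (\prod_(i <- s) p i).
Proof.
move=> cop; rewrite big_seq; apply: (big_ind (fun r => coprimep q r)) => //.
- exact: coprimep1.
- by move=> r1 r2 cr1 cr2; rewrite coprimepMr cr1.
Qed.

Lemma coprime_bigprod_dvdp (F : fieldType) (I : eqType) (p : I -> {poly F})
    (q : {poly F}) (s : seq I) :
  uniq s ->
  {in s &, forall i j, i != j -> coprimep (p i) (p j)} ->
  {in s, forall i, p i %| q} -> \prod_(i <- s) p i %| q.
Proof.
elim: s => [|i0 s IHs] /= => [_ _ _|/andP[i0s us] cop dvd].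
  by rewrite big_nil dvd1p.
rewrite big_cons Gauss_dvdp.
  rewrite dvd ?mem_head //=; apply: IHs => // [i j si sj|i si].
    by apply: cop; rewrite inE (si, sj) orbT.
  by rewrite dvd // inE si orbT.
apply: coprimep_bigprod => i si; apply: cop; rewrite ?inE ?eqxx ?si ?orbT //.
by apply: contraNneq i0s => ->.
Qed.

(** Bezout in the form of the Chinese remainder theorem. Evaluated at a matrix
    that the product annihilates, the [e i] become a decomposition of the
    identity whose [i]-th part is annihilated by [p i]; when the [p i] are powers
    of distinct linear factors, these parts are the spectral projections.
    Divisibility by the product, rather than an exact identity, is what lets the
    induction start from the empty list. *)
Lemma coprime_splitting (F : fieldType) (I : eqType) (p : I -> {poly F})
    (s : seq I) :
  uniq s ->
  {in s &, forall i j, i != j -> coprimep (p i) (p j)} ->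
  exists e : I -> {poly F},
    \prod_(i <- s) p i %| 1 - \sum_(i <- s) e i /\
    {in s, forall i, \prod_(j <- s) p j %| p i * e i}.
Proof.
elim: s => [|i0 s IHs] /= => [_ _|/andP[i0s us] cop].
  by exists (fun=> 0); split => //; rewrite big_nil dvd1p.
have [i j si sj ij|e [sum_e ann_e]] := IHs us.
  by apply: cop; rewrite // inE (si, sj) orbT.
have cop0 : coprimep (p i0) (\prod_(i <- s) p i).
  apply: coprimep_bigprod => i si; apply: cop; rewrite ?inE ?eqxx ?si ?orbT //.
    by apply: contraNneq i0s => ->.
have /Bezout_eq1_coprimepP[[u v] /= uv1] := cop0.
set Pi := \prod_(i <- s) p i in cop0 uv1 sum_e ann_e *.
exists (fun i => if i == i0 then v * Pi else u * p i0 * e i).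
have sumE : \sum_(i <- s) (if i == i0 then v * Pi else u * p i0 * e i) =
            u * p i0 * \sum_(i <- s) e i.
  rewrite mulr_sumr; apply: eq_big_seq => i si.
  by case: eqVneq => // ii0; rewrite ii0 (negPf i0s) in si.
rewrite !big_cons eqxx sumE -/Pi; split.
  have -> : 1 - (v * Pi + u * p i0 * \sum_(j <- s) e j) =
            u * (p i0 * (1 - \sum_(j <- s) e j)) by rewrite -{1}uv1; ring.
  by rewrite dvdp_mull // dvdp_mul.
move=> i; rewrite inE; case: eqVneq => [-> _|_ /= si].
  by rewrite mulrCA dvdp_mull.
have -> : p i * (u * p i0 * e i) = u * (p i0 * (p i * e i)) by ring.
by rewrite dvdp_mull // dvdp_mul // ann_e.
Qed.

Lemma coprimep_XsubC_exp (F : fieldType) (a b : F) (j k : nat) :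
  a != b -> coprimep (('X - a%:P) ^+ j) (('X - b%:P) ^+ k).
Proof.
move=> ab; apply/coprimep_expl/coprimep_expr.
by rewrite coprimep_XsubC root_XsubC eq_sym.
Qed.

(** The factors are pairwise coprime and each divides the characteristic
    polynomial by definition of the multiplicity, hence so does the product; the
    degrees agree because the multiplicities add up to [n]. *)
Lemma char_poly_prod (F : fieldType) (n m : nat) (C : 'M[F]_n)
    (lam : 'I_m -> F) (mu : 'I_m -> nat) :
  injective lam -> (forall i, mu i = mup (lam i) (char_poly C)) ->
  (\sum_i mu i)%N = n ->
  char_poly C = \prod_i ('X - (lam i)%:P) ^+ mu i.
Proof.
move=> lam_inj muE sum_mu.
have chi0 : char_poly C != 0 by rewrite monic_neq0 ?char_poly_monic.
set p := \prod_i _.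
have p_monic : p \is monic by apply: monic_prod => i _; rewrite monic_exp ?monicXsubC.
have size_p : size p = n.+1.
  rewrite size_prod => [|i _]; last by rewrite expf_neq0 ?polyXsubC_eq0.
  under eq_bigr => i _ do rewrite size_exp_XsubC -addn1.
  rewrite big_split /= sum_mu sum1_card card_ord; lia.
have p_dvd : p %| char_poly C.
  rewrite /p; apply: coprime_bigprod_dvdp => [|i j _ _ ij|i _].
  - exact: index_enum_uniq.
  - by apply: coprimep_XsubC_exp; rewrite (inj_eq lam_inj).
  - by rewrite -mup_geq // muE.
apply/eqP; rewrite eq_sym -eqp_monic ?char_poly_monic //.
by rewrite -dvdp_size_eqp // size_p size_char_poly.
Qed.

(** * Laurent coefficients of the resolvent *)

(** With [H i k] in the role of the coefficient of [(z - lam i) ^- k] in the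
    resolvent of [C], these are the relations obtained by comparing coefficients
    in [(z - C) *m resolvent C z = 1]. Every later sum telescopes through them. *)
Definition laurent_chain (F : fieldType) (n m : nat) (C : 'M[F]_n)
    (lam : 'I_m -> F) (mu : 'I_m -> nat) (H : 'I_m -> nat -> 'M[F]_n) : Prop :=
  [/\ \sum_i H i 1%N = 1%:M,
      forall i k, (0 < k)%N -> C *m H i k = lam i *: H i k + H i k.+1 &
      forall i, H i (mu i).+1 = 0].

Lemma horner_mx_XsubC_exp (F : fieldType) (n : nat) (C : 'M[F]_n.+1) (a : F)
    (k : nat) :
  horner_mx C (('X - a%:P) ^+ k) = (C - a%:M) ^+ k.
Proof. by rewrite rmorphXn rmorphB /= horner_mx_X horner_mx_C. Qed.

(** The chain of [i] starts at the spectral projection on the generalized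
    eigenspace of [lam i] and is continued by multiplying with the nilpotent part
    [C - lam i]; it stops after [mu i] steps by Cayley-Hamilton. *)
Lemma laurent_chain_exists (F : fieldType) (n m : nat) (C : 'M[F]_n)
    (lam : 'I_m -> F) (mu : 'I_m -> nat) :
  injective lam -> char_poly C = \prod_i ('X - (lam i)%:P) ^+ mu i ->
  exists H, laurent_chain C lam mu H.
Proof.
case: n C => [|n] C lam_inj chiE.
  (* [horner_mx] asks for a matrix of positive size. *)
  exists (fun _ _ => 0); split=> *; rewrite ?mulmx0 ?scaler0 ?addr0 //.
  by apply/matrixP => - [].
pose p i := ('X - (lam i)%:P) ^+ mu i.
have [||e []] := @coprime_splitting F _ p (index_enum 'I_m).
- exact: index_enum_uniq.
- by move=> i j _ _ ij; apply: coprimep_XsubC_exp; rewrite (inj_eq lam_inj).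
rewrite /p -chiE => sum_e ann_e.
have chi_dvd q : char_poly C %| q -> horner_mx C q = 0.
  by move=> /dvdpP[r ->]; rewrite rmorphM /= Cayley_Hamilton mulr0.
exists (fun i k => (C - (lam i)%:M) ^+ k.-1 *m horner_mx C (e i)); split.
- under eq_bigr => i _ do rewrite /= expr0 mul1mx.
  have := chi_dvd _ sum_e; rewrite rmorphB rmorph1 raddf_sum.
  by move/eqP; rewrite subr_eq0 => /eqP <-.
- move=> i [|k] //= _; rewrite exprS -mulmxE -mulmxA mulmxBl.
  by rewrite mul_scalar_mx [RHS]addrC subrK.
move=> i /=.
rewrite -horner_mx_XsubC_exp mulmxE -[LHS](rmorphM (horner_mx C)).
by apply: chi_dvd; rewrite ann_e ?mem_index_enum.
Qed.

Lemma unitmx_not_eigenvalue (F : fieldType) (n : nat) (C : 'M[F]_n) (z : F) :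
  ~~ eigenvalue C z -> z%:M - C \in unitmx.
Proof.
rewrite /eigenvalue /eigenspace negbK kermx_eq0 row_free_unit => unitCz.
by rewrite -opprB -scaleN1r unitmxZ ?unitrN1.
Qed.

Section Chain.
Variables (F : fieldType) (n m : nat) (C : 'M[F]_n).
Variables (lam : 'I_m -> F) (mu : 'I_m -> nat) (H : 'I_m -> nat -> 'M[F]_n).
Hypothesis chainH : laurent_chain C lam mu H.

(** Multiplying the partial fractions by [z - C] gives, for each eigenvalue, a
    telescoping sum that leaves [H i 1]; these add up to the identity. *)
Lemma resolvent_chain (z : F) :
  (forall i, z != lam i) -> z%:M - C \in unitmx ->
  resolvent C z = \sum_i \sum_(1 <= k < (mu i).+1) (z - lam i) ^- k *: H i k.
Proof.
case: chainH => sumH stepH endH zlam unit_zC; rewrite /resolvent.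
set S := \sum_i _.
suff SE : (z%:M - C) *m S = 1%:M by rewrite -[S](mulKmx unit_zC) SE mulmx1.
rewrite -sumH mulmx_sumr; apply: eq_bigr => i _; rewrite mulmx_sumr.
have zl0 : z - lam i != 0 by rewrite subr_eq0.
rewrite (eq_big_nat _ _ (F2 := fun k =>
    - ((z - lam i) ^- k *: H i k.+1 - (z - lam i) ^- k.-1 *: H i k))).
  rewrite sumrN (telescope_sumr (fun k => (z - lam i) ^- k.-1 *: H i k)) //=.
  by rewrite endH scaler0 sub0r opprK expr0 invr1 scale1r.
move=> [|k] /andP[k0 _] //=; rewrite -scalemxAr mulmxBl mul_scalar_mx stepH //.
rewrite opprD addrA -scalerBl scalerBr opprB; congr (_ - _).
by rewrite scalerA exprSr invfM -mulrA mulVf ?mulr1.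
Qed.

(** The left factor satisfies [C *m H i k = lam i *: H i k + H i k.+1] and the
    right one [N ^+ k *m D = - lam i *: N ^+ k - N ^+ k.-1], so the multiples of
    [lam i] cancel and the rest telescopes to [- H i 1 *m Q]. *)
Lemma lyapunov_chain (p : nat) (D : 'M[F]_p) (Q : 'M[F]_(n, p)) :
  (forall i, (- lam i)%:M - D \in unitmx) ->
  let S := \sum_i \sum_(1 <= k < (mu i).+1)
             H i k *m Q *m mx_negpow ((- lam i)%:M - D) k in
  C *m S + S *m D = - Q.
Proof.
case: chainH => sumH stepH endH unitD S.
rewrite -[in RHS](mul1mx Q) -sumH !mulmx_suml mulmx_sumr -sumrN -big_split /=.
apply: eq_bigr => i _; rewrite mulmx_suml mulmx_sumr -big_split /=.
rewrite /mx_negpow; set N := invmx _; have unitDi := unitD i.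
have stepN k : N ^+ k.+1 *m D = - lam i *: N ^+ k.+1 - N ^+ k.
  rewrite -[D in LHS](subKr (- lam i)%:M) mulmxBr mul_mx_scalar; congr (_ - _).
  by rewrite exprSr -mulmxE -mulmxA mulVmx ?mulmx1.
rewrite (eq_big_nat _ _ (F2 := fun k =>
    H i k.+1 *m Q *m N ^+ k - H i k *m Q *m N ^+ k.-1)).
  rewrite (telescope_sumr (fun k => H i k *m Q *m N ^+ k.-1)) //=.
  by rewrite endH !mul0mx sub0r expr0 mulmx1.
move=> [|k] /andP[k0 _] //=.
rewrite -!mulmxA stepN !(mulmxA C) stepH // mulmxDl -scalemxAl !mulmxBr.
rewrite -!scalemxAr scaleNr !mulmxA addrAC.
by rewrite addrA addrN add0r addrC.
Qed.

End Chain.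

(** A solution of the homogeneous equation intertwines [C] with [- D], hence also
    [p(C)] with [p(- D)] for every polynomial [p]. For the characteristic
    polynomial of [C] the former is zero, and the latter is invertible because
    [- D] has no eigenvalue in common with [C]. *)
Lemma sylvester_uniq (F : fieldType) (n m : nat) (C D : 'M[F]_n)
    (lam : 'I_m -> F) (mu : 'I_m -> nat) (X : 'M[F]_n) :
  char_poly C = \prod_i ('X - (lam i)%:P) ^+ mu i ->
  (forall i, (- lam i)%:M - D \in unitmx) ->
  C *m X + X *m D = 0 -> X = 0.
Proof.
case: n C D X => [|n] C D X chiE unitD /eqP; first by move=> _; apply/matrixP => - [].
rewrite addr_eq0 -mulmxN => /eqP CX.
have CXp p : horner_mx C p *m X = X *m horner_mx (- D) p.
  elim/poly_ind: p => [|p c IHp]; first by rewrite !rmorph0 mul0mx mulmx0.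
  rewrite !rmorphD !rmorphM /= !horner_mx_C !horner_mx_X mulmxDl mulmxDr.
  rewrite mul_scalar_mx mul_mx_scalar -!mulmxE -mulmxA CX mulmxA IHp -mulmxA.
  by rewrite mulmxN.
have := CXp (char_poly C); rewrite Cayley_Hamilton mul0mx chiE => XP0.
suff unitP : horner_mx (- D) (\prod_i ('X - (lam i)%:P) ^+ mu i) \in unitmx.
  by rewrite -[X](mulmxK unitP) -XP0 mul0mx.
rewrite rmorph_prod /=; elim/big_ind: _ => [|P1 P2 u1 u2|i _].
- exact: unitmx1.
- by rewrite -mulmxE unitmx_mul u1.
rewrite horner_mx_XsubC_exp; apply: unitrX.
by rewrite addrC -[X in X - D]raddfN; apply: unitD.
Qed.

(** * Taylor coefficients of the continued resolvent at an eigenvalue *)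

Lemma near_neq (K : numFieldType) (a b : K) :
  a != b -> \forall z \near a, z != b.
Proof.
move=> ab; have ab0 : 0 < `|a - b| by rewrite normr_gt0 subr_eq0.
near=> z; have : ball a `|a - b| z by near: z; exact: nbhsx_ballx.
by apply: contraTneq => ->; rewrite /ball /= ltxx.
Unshelve. all: by end_near. Qed.

Section Jets.
Variables (K : numFieldType) (V : normedModType K).
Implicit Types (f g : K -> V) (a b z : K) (c : V).

(** [derive1n d f a] is meaningful only through values of lower derivatives near
    [a]; a jet records this differentiability together with the value, which
    makes the notion additive and local. *)
Fixpoint jet (d : nat) (f : K -> V) (a : K) (c : V) : Prop :=
  if d is d'.+1 then (\forall z \near a, derivable f z 1) /\ jet d' (derive1 f) a c
  else f a = c.

Lemma jet_near d f g a c : {near a, f =1 g} -> jet d f a c -> jet d g a c.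
Proof.
elim: d f g => [|d IHd] f g fg /=; first by rewrite (nbhs_singleton fg).
have fg' : \forall z \near a, {near z, f =1 g} by exact: near_join.
case=> df jf; split.
  by near=> z; apply: (@near_eq_derivable _ _ _ f); near: z.
apply: IHd jf; near=> z; rewrite !derive1E; apply: near_eq_derive.
by near: z.
Unshelve. all: by end_near. Qed.

Lemma jet_derive1n d f a c : jet d f a c -> derive1n d f a = c.
Proof. by elim: d f => [|d IHd] f //= [_ /IHd <-]; rewrite -derive1Sn. Qed.

Lemma jet_is_derive d f f' a c :
  (\forall z \near a, is_derive (z : K) (1 : K) f (f' z)) -> jet d f' a c -> jet d.+1 f a c.
Proof.
move=> df jf'; split; first by near=> z; have [] : is_derive (z : K) (1 : K) f (f' z) by near: z.
apply: jet_near jf'; near=> z.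
have [_ <-] : is_derive (z : K) (1 : K) f (f' z) by near: z.
by rewrite derive1E.
Unshelve. all: by end_near. Qed.

Lemma jetD d f g a c e : jet d f a c -> jet d g a e -> jet d (f \+ g) a (c + e).
Proof.
elim: d f g => [|d IHd] f g /=; first by move=> <- <-.
move=> [df jf] [dg jg]; split; first by near=> z; apply: derivableD; near: z.
apply: jet_near (IHd _ _ jf jg); near=> z.
by rewrite /= !derive1E deriveD //; near: z.
Unshelve. all: by end_near. Qed.

Lemma jet0 d a : jet d (cst 0) a (0 : V).
Proof.
elim: d => //= d IHd; split; first by near=> z; exact: derivable_cst.
apply: jet_near IHd; near=> z.
by rewrite derive1E derive_cst.
Unshelve. all: by end_near. Qed.

Lemma jet_sum d (I : Type) (r : seq I) (P : pred I) (f : I -> K -> V) a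
    (c : I -> V) :
  (forall i, P i -> jet d (f i) a (c i)) ->
  jet d (fun z => \sum_(i <- r | P i) f i z) a (\sum_(i <- r | P i) c i).
Proof.
move=> jf; elim: r => [|i r IHr].
  by rewrite big_nil; under [X in jet _ X]eq_fun do rewrite big_nil; exact: jet0.
rewrite big_cons; under [X in jet _ X]eq_fun do rewrite big_cons.
by case: ifP => // Pi; apply: jetD => //; apply: jf.
Qed.

Lemma is_derive_scalel (h : K -> K) (h' z : K) c :
  is_derive z 1 h h' -> is_derive z 1 (fun y => h y *: c) (h' *: c).
Proof.
case=> /derivable1_diffP dh <-.
have dhc := differentiableZl c dh.
apply: DeriveDef; first exact/derivable1_diffP.
by rewrite -derive1E derive1E' // diffZl // -derive1E' // derive1E.
Qed.

Lemma is_derive_pole_factor a b (N k : nat) z : z != b ->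
  is_derive z 1 (fun y => (y - a) ^+ N * (y - b) ^- k)
    (N%:R * ((z - a) ^+ N.-1 * (z - b) ^- k) -
     k%:R * ((z - a) ^+ N * (z - b) ^- k.+1)).
Proof.
move=> zb; have zb0 : z - b != 0 by rewrite subr_eq0.
have dl (w : K) : is_derive z 1 (fun y : K => y - w) 1.
  by rewrite -[X in is_derive _ _ _ X]subr0; apply: is_deriveB.
have dN := is_deriveX N (dl a); have dk := is_deriveX k (dl b).
have bk0 : ((fun y : K => y - b) ^+ k) z != 0 by rewrite exprfctE expf_neq0.
have dV : is_derive z 1 (fun y => (((fun y : K => y - b) ^+ k) y)^-1)
    (- k%:R * (z - b) ^- k.+1).
  case: dk => dk1 dk2; apply: DeriveDef; first exact: derivableV.
  rewrite deriveV // dk2 exprfctE /GRing.scale /= mulr1.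
  case: (k) => [|k'] /=; first by rewrite oppr0 !mul0r mulr0.
  by rewrite !exprS; field; rewrite zb0 expf_neq0.
have := is_deriveM dN dV; rewrite !exprfctE => dNV.
apply: is_derive_eq dNV _; rewrite /GRing.scale /= mulr1.
rewrite [LHS]addrC; congr (_ + _).
  by rewrite mulrC mulrA.
by rewrite !mulNr mulrN mulrCA.
Qed.

(** The derivatives of order below [N] vanish, because of the factor
    [(z - a) ^+ N]: the poles at the other eigenvalues do not contribute to the
    Taylor coefficients in question. *)
Lemma jet_pole_factor d a b (N k : nat) c : a != b -> (d <= N)%N ->
  jet d (fun z => ((z - a) ^+ N * (z - b) ^- k) *: c) a
    (if d == N then N`!%:R *: ((a - b) ^- k *: c) else 0).
Proof.
move=> ab; elim: d N k c => [|d IHd] N k c dN /=.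
  rewrite subrr; case: N dN => [|N] _ /=; first by rewrite expr0 mul1r scale1r.
  by rewrite expr0n /= mul0r scale0r.
case: N dN => // N dN.
pose f' z := ((z - a) ^+ N * (z - b) ^- k) *: (N.+1%:R *: c) +
             ((z - a) ^+ N.+1 * (z - b) ^- k.+1) *: (- k%:R *: c).
apply: (@jet_is_derive _ _ f').
  near=> z; have zb : z != b.
    by near: z; exact: near_neq.
  apply: is_derive_eq (is_derive_scalel _ (is_derive_pole_factor a N.+1 k zb)) _.
  by rewrite /f' !scalerA -scalerDl; congr (_ *: _); rewrite /=; ring.
have -> : (if d.+1 == N.+1 then N.+1`!%:R *: ((a - b) ^- k *: c) else 0) =
  (if d == N then N`!%:R *: ((a - b) ^- k *: (N.+1%:R *: c)) else 0) + 0 :> V.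
  rewrite addr0 eqSS; case: eqP => // _.
  by rewrite factS natrM !scalerA; congr (_ *: _); ring.
apply: jetD; first exact: IHd.
by have := IHd N.+1 k.+1 (- k%:R *: c) (leqW dN); rewrite ltn_eqF.
Unshelve. all: by end_near. Qed.

Lemma jet_monomial d a (N : nat) c :
  jet d (fun z => (z - a) ^+ N *: c) a (if d == N then N`!%:R *: c else 0).
Proof.
elim: d N c => [|d IHd] N c /=.
  rewrite subrr expr0n; case: N => [|N] /=; last by rewrite scale0r.
  by rewrite fact0.
pose f' z := (z - a) ^+ N.-1 *: (N%:R *: c).
apply: (@jet_is_derive _ _ f').
  near=> z; have dl : is_derive z 1 (fun y : K => y - a) 1.
    by rewrite -[X in is_derive _ _ _ X]subr0; apply: is_deriveB.
  have := is_derive_scalel c (is_deriveX N dl); rewrite !exprfctE => dc.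
  apply: is_derive_eq dc _.
  rewrite /f' [RHS]scalerA; congr (_ *: _).
  by rewrite /GRing.scale /= mulr1 mulrC.
have := IHd N.-1 (N%:R *: c); rewrite {}/f'; case: N => [|N] /=.
  by rewrite scale0r scaler0 if_same.
by rewrite eqSS factS natrM mulrC scalerA.
Unshelve. all: by end_near. Qed.

End Jets.

(** Two continuations agree off [a] by definition, and at [a] by continuity. *)
Lemma analytic_continuation_near (K : numFieldType) (n : nat)
    (f h : K -> 'M[K]_n) (a : K) :
  is_analytic_continuation f a h ->
  \forall z \near a, analytic_continuation f a z = h z.
Proof.
move=> hcont; set g := analytic_continuation f a.
have [dg gf] : is_analytic_continuation f a g.
  exact: (xgetPex f (ex_intro _ h hcont)).
have [dh hf] := hcont.
have gh : \forall z \near a^', g z = h z.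
  by near=> z; rewrite (near gf z) // (near hf z).
have cts (u : K -> 'M[K]_n) : (\forall z \near a, derivable u z 1) ->
    u @ a^' --> u a.
  move=> /nbhs_singleton/derivable1_diffP/differentiable_continuous.
  by move/continuous_withinNx.
have gha : g a = h a.
  have hausM := @norm_hausdorff K 'M[K]_n.
  apply: (cvg_unique hausM (cts g dg)).
  have hg : \forall z \near a^', h z = g z by near=> z; rewrite (near gh z).
  exact: cvg_trans (near_eq_cvg hg) (cts h dh).
have gh_off : \forall z \near a, z != a -> g z = h z by [].
near=> z; have [->//|] := eqVneq z a.
by near: z.
Unshelve. all: by end_near. Qed.

(** By the partial fraction expansion, the function to be continued is a sum of
    monomials in [z - lam i] and of terms [(z - lam i) ^+ mu i] times a power
    regular at [lam i]. The derivative of order [mu i - k] at [lam i] sees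
    only the monomial that carries [H i k]. *)
Lemma resolvent_coef_chain (K : numFieldType) (n m : nat) (C : 'M[K]_n)
    (lam : 'I_m -> K) (mu : 'I_m -> nat) (H : 'I_m -> nat -> 'M[K]_n) :
  injective lam -> laurent_chain C lam mu H ->
  (forall z, (forall i, z != lam i) -> z%:M - C \in unitmx) ->
  forall i k, (0 < k <= mu i)%N -> resolvent_coef C (lam i) (mu i) k = H i k.
Proof.
move=> lam_inj chainH unit_zC i k /andP[k0 k_mu].
set a := lam i; set d := (mu i - k)%N.
pose u j l z := if j == i then (z - a) ^+ (mu i - l) *: H i l
  else ((z - a) ^+ mu i * (z - lam j) ^- l) *: H j l.
pose h z := \sum_j \sum_(1 <= l < (mu j).+1) u j l z.
have jet_h e : (e <= mu i)%N ->
    jet e h a (\sum_j \sum_(1 <= l < (mu j).+1)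
      if j == i then if e == (mu i - l)%N then (mu i - l)`!%:R *: H i l else 0
      else if e == mu i then (mu i)`!%:R *: ((a - lam j) ^- l *: H j l) else 0).
  move=> e_mu; apply: jet_sum => j _; apply: jet_sum => l _.
  rewrite /u; have [ij|ij] := eqVneq j i; first exact: jet_monomial.
  have al : a != lam j by rewrite /a (inj_eq lam_inj) eq_sym.
  exact: jet_pole_factor l (H j l) al e_mu.
have cont_h : is_analytic_continuation
    (fun z => (z - a) ^+ mu i *: resolvent C z) a h.
  (* Differentiability near [a] is part of a jet of order 1. *)
  split; first by have [] := jet_h 1%N (leq_trans k0 k_mu).
  near=> z; have zlam j : z != lam j.
    move: j; near: z; apply: filter_forall => j.
    have [->|ij] := eqVneq j i; first exact: nbhs_dnbhs_neq.
    by apply/nbhs_dnbhs/near_neq; rewrite /a (inj_eq lam_inj) eq_sym.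
  rewrite (resolvent_chain chainH) //; last exact: unit_zC.
  rewrite /h scaler_sumr; apply: eq_bigr => j _.
  rewrite scaler_sumr; apply: eq_big_nat => l /andP[_ l_mu].
  rewrite /u scalerA; case: eqVneq => // ji; rewrite ji ltnS in l_mu *; congr (_ *: _).
  rewrite -[X in _ ^+ X / _](subnK l_mu).
  by rewrite exprD mulfK // expf_neq0 // subr_eq0 zlam.
rewrite /resolvent_coef -/a -/d.
have /jet_derive1n -> : jet d (analytic_continuation
    (fun z => (z - a) ^+ mu i *: resolvent C z) a) a (d`!%:R *: H i k).
  apply: (@jet_near _ _ _ h).
    by near=> z; apply/esym; near: z; exact: analytic_continuation_near.
  have := jet_h d (leq_subr _ _); congr (jet d h a _).
  have d_mu : (d < mu i)%N by rewrite /d; lia.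
  rewrite (bigD1 i) //= [X in _ + X]big1 ?addr0 => [|j ij]; last first.
    by rewrite big1 // => l _; rewrite (negPf ij) ltn_eqF.
  rewrite (bigD1_seq k) /= ?mem_index_iota ?iota_uniq ?k0 //=.
  rewrite !eqxx [X in _ + X]big1_seq ?addr0 // => l.
  rewrite mem_index_iota => /and3P[lk _ l_mu].
  by case: eqP => // dl; exfalso; move: lk l_mu; rewrite /d in dl *; lia.
by rewrite scalerA mulVf ?scale1r // pnatr_eq0 -lt0n fact_gt0.
Unshelve. all: by end_near. Qed.

(** * Entrywise limits of complex matrices *)

(** The topology of [R[i]] comes from its structure of numFieldType, so a matrix
    space over it is a topological space only when the coefficients are
    presented in this way. *)
Definition complex_numField (R : realType) : numFieldType := R[i].

Section ReIm.
Variable R : realType.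
Implicit Types x y : R[i].

Lemma reD x y : re (x + y) = re x + re y. Proof. by case: x; case: y. Qed.
Lemma imD x y : im (x + y) = im x + im y. Proof. by case: x; case: y. Qed.
Lemma reM x y : re (x * y) = re x * re y - im x * im y.
Proof. by case: x; case: y. Qed.
Lemma imM x y : im (x * y) = re x * im y + im x * re y.
Proof. by case: x; case: y. Qed.

Lemma re_sum (I : Type) (r : seq I) (P : pred I) (f : I -> R[i]) :
  re (\sum_(i <- r | P i) f i) = \sum_(i <- r | P i) re (f i).
Proof. exact: (big_morph (@complex.Re R) reD). Qed.

Lemma im_sum (I : Type) (r : seq I) (P : pred I) (f : I -> R[i]) :
  im (\sum_(i <- r | P i) f i) = \sum_(i <- r | P i) im (f i).
Proof. exact: (big_morph (@complex.Im R) imD). Qed.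

End ReIm.

Section EntrywiseConvergence.
Variable R : realType.

Lemma normc_le_ReIm (z : R[i]) : `|z| <= (`|re z| + `|im z|)%:C.
Proof.
have norm_real (x : R) : `|x%:C| = `|x|%:C.
  by rewrite normc_def /= expr0n addr0 sqrtr_sqr.
have norm_i : `|Complex 0 1 : R[i]| = 1.
  by rewrite normc_def /= expr0n expr1n add0r sqrtr1.
rewrite [z in leLHS]complexE (le_trans (ler_normD _ _)) // normrM.
by rewrite norm_i mul1r !norm_real rmorphD.
Qed.

Lemma normc_ge_Im (z : R[i]) : `|im z|%:C <= `|z|.
Proof.
by rewrite normc_def lecR -sqrtr_sqr ler_wsqrtr // lerDr sqr_ge0.
Qed.

(** Limits and, below, derivatives of complex matrices are taken entry by entry in
    the real and imaginary parts: this gives access to the completeness of [R] and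
    to its theory of power series, and allows differentiation in a real variable,
    whereas the matrices over [R[i]] are a normed module over [R[i]] only. *)
Definition mx_cvg (m n : nat) (u : nat -> 'M[R[i]]_(m, n)) (l : 'M[R[i]]_(m, n)) :=
  forall i j, (fun k => re (u k i j)) @ \oo --> re (l i j) /\
              (fun k => im (u k i j)) @ \oo --> im (l i j).

Lemma mx_cvg_cvg (m n : nat) (u : nat -> 'M[complex_numField R]_(m, n))
    (l : 'M[complex_numField R]_(m, n)) :
  mx_cvg u l -> u @ \oo --> l.
Proof.
move=> ul; apply/cvg_ballP => e e0.
have [r r0 ->] : exists2 r : R, 0 < r & e = r%:C.
  exists (re e); last by move: e0; case: e => a b; rewrite ltcE /= => /andP[/eqP -> _].
  by move: e0; rewrite ltcE => /andP[].
have near_entry i j : \forall k \near \oo, ball (l i j) r%:C (u k i j).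
  have [/cvgr_dist_lt cR /cvgr_dist_lt cI] := ul i j.
  near=> k; rewrite /ball /=; apply: le_lt_trans (normc_le_ReIm _) _.
  rewrite ltcR (splitr r) !raddfB /= ltrD //; near: k.
    by apply: cR; rewrite divr_gt0.
  by apply: cI; rewrite divr_gt0.
near=> k; split; first by rewrite ltcR.
near: k.
apply: filter_forall => i; apply: filter_forall => j; exact: near_entry.
Unshelve. all: by end_near. Qed.

Lemma mx_cvg_mull (m n p : nat) (L : 'M[R[i]]_(m, n)) (u : nat -> 'M[R[i]]_(n, p))
    (l : 'M[R[i]]_(n, p)) :
  mx_cvg u l -> mx_cvg (fun k => L *m u k) (L *m l).
Proof.
move=> ul i j; rewrite !mxE re_sum im_sum; split.
  under eq_fun do rewrite mxE re_sum; apply: (cvg_big add_continuous) => r _.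
  have [cR cI] := ul r j; rewrite reM; under eq_fun do rewrite reM.
  by apply: cvgB; apply: cvgMl_tmp.
under eq_fun do rewrite mxE im_sum; apply: (cvg_big add_continuous) => r _.
have [cR cI] := ul r j; rewrite imM; under eq_fun do rewrite imM.
by apply: cvgD; apply: cvgMl_tmp.
Qed.

Lemma mx_cvg_mulr (m n p : nat) (u : nat -> 'M[R[i]]_(m, n)) (L : 'M[R[i]]_(n, p))
    (l : 'M[R[i]]_(m, n)) :
  mx_cvg u l -> mx_cvg (fun k => u k *m L) (l *m L).
Proof.
move=> ul; have ulT : mx_cvg (fun k => (u k)^T) l^T.
  by move=> i j; rewrite mxE; under eq_fun do rewrite mxE;
     under [X in _ /\ X @ _ --> _]eq_fun do rewrite mxE.
move=> i j; have := mx_cvg_mull L^T ulT j i.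
rewrite -trmx_mul mxE; under eq_fun do rewrite -trmx_mul mxE.
by under [X in _ /\ X @ _ --> _ -> _]eq_fun do rewrite -trmx_mul mxE.
Qed.

Lemma mx_cvg_unique (m n : nat) (u : nat -> 'M[R[i]]_(m, n)) (l l' : 'M[R[i]]_(m, n)) :
  mx_cvg u l -> mx_cvg u l' -> l = l'.
Proof.
move=> ul ul'; apply/matrixP => i j; apply/eqP; rewrite eq_complex.
have [lR lI] := ul i j; have [lR' lI'] := ul' i j.
by rewrite (cvg_unique _ lR lR') // (cvg_unique _ lI lI') // !eqxx.
Qed.

End EntrywiseConvergence.

(** * Complex matrices depending on a real parameter *)

Section RealTimeDerivative.
Variable R : realType.

Definition mx_derive (m n : nat) (F : R -> 'M[R[i]]_(m, n)) (t : R)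
    (D : 'M[R[i]]_(m, n)) : Prop :=
  forall i j, is_derive t 1 (fun s => re (F s i j)) (re (D i j)) /\
              is_derive t 1 (fun s => im (F s i j)) (im (D i j)).

Lemma mx_derive_cst (m n : nat) (L : 'M[R[i]]_(m, n)) t :
  mx_derive (fun=> L) t 0.
Proof. by move=> i j; rewrite mxE; split; exact: is_derive_cst. Qed.

Lemma mx_deriveD (m n : nat) (F G : R -> 'M[R[i]]_(m, n)) t D E :
  mx_derive F t D -> mx_derive G t E ->
  mx_derive (fun s => F s + G s) t (D + E).
Proof.
move=> dF dG i j; have [] := dF i j; have [] := dG i j => ? ? ? ?.
rewrite mxE reD imD; split.
  by under eq_fun do rewrite mxE reD; exact: is_deriveD.
by under eq_fun do rewrite mxE imD; exact: is_deriveD.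
Qed.

Lemma mx_derive_sum (m n : nat) (I : Type) (r : seq I) (P : pred I)
    (F : I -> R -> 'M[R[i]]_(m, n)) t (D : I -> 'M[R[i]]_(m, n)) :
  (forall i, P i -> mx_derive (F i) t (D i)) ->
  mx_derive (fun s => \sum_(i <- r | P i) F i s) t (\sum_(i <- r | P i) D i).
Proof.
move=> dF; elim: r => [|i r IHr].
  rewrite big_nil; under [X in mx_derive X]eq_fun do rewrite big_nil.
  exact: mx_derive_cst.
rewrite big_cons; under [X in mx_derive X]eq_fun do rewrite big_cons.
by case: ifP => // Pi; apply: mx_deriveD => //; exact: dF.
Qed.

Lemma mx_deriveM (m n p : nat) (F : R -> 'M[R[i]]_(m, n))
    (G : R -> 'M[R[i]]_(n, p)) t D E :
  mx_derive F t D -> mx_derive G t E ->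
  mx_derive (fun s => F s *m G s) t (D *m G t + F t *m E).
Proof.
move=> dF dG i j; rewrite !mxE -big_split re_sum im_sum; split.
  under eq_fun do rewrite mxE re_sum; rewrite -fct_sumE; apply: is_derive_sum => r.
  have [dFr dFi] := dF i r; have [dGr dGi] := dG r j.
  under eq_fun do rewrite reM.
  apply: is_derive_eq (is_deriveB (is_deriveM dFr dGr) (is_deriveM dFi dGi)) _.
  by rewrite /GRing.scale /= reD !reM; ring.
under eq_fun do rewrite mxE im_sum; rewrite -fct_sumE; apply: is_derive_sum => r.
have [dFr dFi] := dF i r; have [dGr dGi] := dG r j.
under eq_fun do rewrite imM.
apply: is_derive_eq (is_deriveD (is_deriveM dFr dGi) (is_deriveM dFi dGr)) _.
by rewrite /GRing.scale /= imD !imM; ring.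
Qed.

(** That exponentials are invertible and that the differential equation has one
    solution both come down to this. *)
Lemma mx_derive0_cst (m n : nat) (F : R -> 'M[R[i]]_(m, n)) :
  (forall t, mx_derive F t 0) -> forall s t, F s = F t.
Proof.
move=> dF s t; apply/matrixP => i j; apply/eqP; rewrite eq_complex.
apply/andP; split; apply/eqP.
  apply: (@is_derive_0_is_cst _ (fun s => re (F s i j))) => u.
  by have [] := dF u i j; rewrite mxE.
apply: (@is_derive_0_is_cst _ (fun s => im (F s i j))) => u.
by have [] := dF u i j; rewrite mxE.
Qed.

Lemma mx_derive_complex (m n : nat) (F : R -> 'M[R]_(m, n)) t :
  derivable F t 1 -> mx_derive (fun s => complex_mx (F s)) t (complex_mx (derive1 F t)).
Proof.
move=> dF i j; rewrite derive1E (derive_mx dF) !mxE /=; split.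
  under eq_fun do rewrite mxE /=.
  by apply/derivableP; move/derivable_mxP: dF; apply.
by under eq_fun do rewrite mxE /=; exact: is_derive_cst.
Qed.

End RealTimeDerivative.

(** * The matrix exponential *)

Section PowerSeries.
Variable R : realType.
Implicit Types (v : nat -> R) (B rho x t : R).

Lemma is_cvg_pseries_fact v B rho x : 0 <= B -> 0 <= rho ->
  (forall k, `|v k| <= B * rho ^+ k) ->
  cvgn (pseries (fun k => v k / k`!%:R) x).
Proof.
move=> B0 rho0 v_le; apply: normed_cvg => /=.
apply: (@series_le_cvg _ _ (fun k => B * exp_coeff (rho * `|x|) k)).
- by move=> k; rewrite normr_ge0.
- by move=> k; rewrite mulr_ge0 // exp_coeff_ge0 ?mulr_ge0.
- move=> k; rewrite /exp_coeff /= exprMn !normrM normfV normr_nat normrX.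
  have -> : B * (rho ^+ k * `|x| ^+ k / k`!%:R) =
            B * rho ^+ k / k`!%:R * `|x| ^+ k by ring.
  by rewrite !ler_wpM2r ?exprn_ge0 ?invr_ge0.
have -> : (fun k => B * exp_coeff (rho * `|x|) k) = B *: exp_coeff (rho * `|x|).
  by [].
by apply: is_cvg_seriesZ; exact: is_cvg_series_exp_coeff.
Qed.

(** Differentiation shifts the sequence [v], which keeps a geometric bound; so
    the two derived series that termwise differentiation asks for converge. *)
Lemma is_derive_pseries_fact v B rho t : 0 <= B -> 0 <= rho ->
  (forall k, `|v k| <= B * rho ^+ k) ->
  is_derive t 1 (fun x => limn (pseries (fun k => v k / k`!%:R) x))
    (limn (pseries (fun k => v k.+1 / k`!%:R) t)).
Proof.
move=> B0 rho0 v_le.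
have diffs u : pseries_diffs (fun k => u k / k`!%:R) = (fun k => u k.+1 / k`!%:R) :> (nat -> R).
  apply/funext => k; rewrite /pseries_diffs factS natrM.
  by field; rewrite nat1r !pnatr_eq0 -lt0n fact_gt0.
have shift_le (u : nat -> R) (b : R) : (forall k, `|u k| <= b * rho ^+ k) ->
    forall k, `|u k.+1| <= b * rho * rho ^+ k.
  by move=> u_le k; rewrite -mulrA -exprS.
have v1_le := shift_le _ _ v_le.
have v2_le := shift_le _ _ v1_le.
rewrite -diffs; apply: (@pseries_snd_diffs _ _ (`|t| + 1)).
- exact: is_cvg_pseries_fact v_le.
- by rewrite diffs; apply: is_cvg_pseries_fact v1_le => //; rewrite mulr_ge0.
- rewrite !diffs; apply: is_cvg_pseries_fact v2_le => //; rewrite !mulr_ge0 //.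
- by rewrite [ltRHS]ger0_norm ?ltrDl // addr_ge0.
Qed.

End PowerSeries.

Lemma expmx0 (K : numFieldType) (n : nat) : expmx (0 : 'M[K]_n) = 1%:M.
Proof.
apply: cvg_lim; first exact: norm_hausdorff.
apply: cvg_near_cst; near=> N.
have -> : N = N.-1.+1 by rewrite prednK //; near: N; exact: nbhs_infty_gt.
rewrite /series /= big_nat_recl // expr0 fact0 invr1 scale1r.
by rewrite big1 ?addr0 // => k _; rewrite expr0n scaler0.
Unshelve. all: by end_near. Qed.

Section MatrixExponential.
Variables (R : realType) (n : nat) (M : 'M[R[i]]_n).
Implicit Types (t : R).

(* The sum of all norms of entries bounds every row sum of [M], so its powers
   dominate the entries of the powers of [M]. *)
Let rho : R := re (\sum_i \sum_j `|M i j|).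

Let rhoE : \sum_i \sum_j `|M i j| = rho%:C.
Proof. by apply/esym/RRe_real; rewrite ger0_real // sumr_ge0 // => i _; rewrite sumr_ge0. Qed.

Let rho_ge0 : 0 <= rho.
Proof. by rewrite -ler0c -rhoE sumr_ge0 // => i _; rewrite sumr_ge0. Qed.

Let expr_entry_le k i j : `|(M ^+ k) i j| <= (rho ^+ k)%:C.
Proof.
elim: k i j => [|k IHk] i j.
  by rewrite !expr0 mxE; case: eqP => _; rewrite ?normr0 ?normr1 ?ler01.
have row_le : \sum_l `|M i l| <= rho%:C.
  rewrite -rhoE [leRHS](bigD1 i) //= lerDl sumr_ge0 // => r _; exact: sumr_ge0.
rewrite exprS mxE (le_trans (ler_norm_sum _ _ _)) // exprS rmorphM /=.
apply: le_trans (ler_wpM2r _ row_le); last by rewrite ler0c exprn_ge0.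
by rewrite mulr_suml ler_sum // => l _; rewrite normrM ler_wpM2l.
Qed.

Let re_entry_le k i j : `|re ((M ^+ k) i j)| <= 1 * rho ^+ k.
Proof.
by rewrite mul1r -lecR (le_trans (normc_ge_Re _)).
Qed.

Let im_entry_le k i j : `|im ((M ^+ k) i j)| <= 1 * rho ^+ k.
Proof.
by rewrite mul1r -lecR (le_trans (normc_ge_Im _)).
Qed.

Let expr_scale t k : (t%:C *: M) ^+ k = (t ^+ k)%:C *: M ^+ k.
Proof.
elim: k => [|k IHk]; first by rewrite !expr0 scale1r.
rewrite !exprS IHk -[LHS]scalemxAl -scalemxAr scalerA.
by rewrite -[X in X *: _](rmorphM (real_complex R)).
Qed.

Let term t k := (k`!%:R)^-1 *: (t%:C *: M) ^+ k : 'M[complex_numField R]_n.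

Let entry_term t k i j :
  term t k i j = (t ^+ k / k`!%:R)%:C * (M ^+ k) i j.
Proof.
rewrite /term expr_scale !mxE mulrA; congr (_ * _).
by rewrite rmorphM fmorphV rmorph_nat mulrC.
Qed.

Let re_series t N i j :
  re (series (term t) N i j) =
  pseries (fun k => re ((M ^+ k) i j) / k`!%:R) t N.
Proof.
rewrite /pseries /series /= summxE re_sum; apply: eq_bigr => k _.
by rewrite entry_term reM /=; ring.
Qed.

Let im_series t N i j :
  im (series (term t) N i j) =
  pseries (fun k => im ((M ^+ k) i j) / k`!%:R) t N.
Proof.
rewrite /pseries /series /= summxE im_sum; apply: eq_bigr => k _.
by rewrite entry_term imM /=; ring.
Qed.

Let E t : 'M[R[i]]_n := expmx (t%:C *: M).

Let cvg_series t : mx_cvg (series (term t)) (E t).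
Proof.
pose l : 'M[complex_numField R]_n := \matrix_(i, j)
  (limn (pseries (fun k => re ((M ^+ k) i j) / k`!%:R) t) +i*
   limn (pseries (fun k => im ((M ^+ k) i j) / k`!%:R) t)).
have cvg_l : mx_cvg (series (term t)) l.
  move=> i j; rewrite mxE /=; under eq_fun do rewrite re_series.
  under [X in _ /\ X @ _ --> _]eq_fun do rewrite im_series.
  split; [exact: is_cvg_pseries_fact ler01 rho_ge0 (fun k => re_entry_le k i j)
         |exact: is_cvg_pseries_fact ler01 rho_ge0 (fun k => im_entry_le k i j)].
suff -> : E t = l by [].
have hausM := @norm_hausdorff (complex_numField R) 'M[complex_numField R]_n.
exact: (cvg_lim hausM (mx_cvg_cvg cvg_l)).
Qed.

Let E_re t i j : re (E t i j) = limn (pseries (fun k => re ((M ^+ k) i j) / k`!%:R) t).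
Proof.
have [cR _] := cvg_series t i j; apply/esym/cvg_lim => //.
by move: cR; under eq_fun do rewrite re_series.
Qed.

Let E_im t i j : im (E t i j) = limn (pseries (fun k => im ((M ^+ k) i j) / k`!%:R) t).
Proof.
have [_ cI] := cvg_series t i j; apply/esym/cvg_lim => //.
by move: cI; under eq_fun do rewrite im_series.
Qed.

(** Differentiating a product of exponentials produces [M] on the inner side;
    commutation brings it back. *)
Lemma mulmx_expmxC t : M *m expmx (t%:C *: M) = expmx (t%:C *: M) *m M.
Proof.
have cvg1 := mx_cvg_mull M (cvg_series t).
have cvg2 := mx_cvg_mulr M (cvg_series t).
have comm_series N : M *m series (term t) N = series (term t) N *m M.
  rewrite /series /= mulmx_sumr mulmx_suml; apply: eq_bigr => k _.
  rewrite /term expr_scale -!scalemxAr -!scalemxAl; congr (_ *: (_ *: _)).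
  by rewrite -[LHS]exprS exprSr.
apply: (mx_cvg_unique cvg1) => i j; have [cR cI] := cvg2 i j.
by split; under eq_fun do rewrite comm_series.
Qed.

Lemma mx_derive_expmx t :
  mx_derive (fun s => expmx (s%:C *: M)) t (M *m expmx (t%:C *: M)).
Proof.
move=> i j; rewrite -!/(E _).
have [cR cI] := mx_cvg_mull M (cvg_series t) i j.
have termS k : (M *m term t k) i j = (t ^+ k / k`!%:R)%:C * (M ^+ k.+1) i j.
  rewrite exprS mxE [in RHS]mxE mulr_sumr; apply: eq_bigr => l _.
  by rewrite entry_term; ring.
split.
  under eq_fun do rewrite E_re.
  have <- : limn (pseries (fun k => re ((M ^+ k.+1) i j) / k`!%:R) t) =
            re ((M *m E t) i j).
    apply: cvg_lim => //; apply: cvg_trans cR; apply: near_eq_cvg.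
    near=> N; rewrite /pseries /series /= mulmx_sumr summxE re_sum.
    by apply: eq_bigr => k _; rewrite termS reM /=; ring.
  exact: is_derive_pseries_fact ler01 rho_ge0 (fun k => re_entry_le k i j).
under eq_fun do rewrite E_im.
have <- : limn (pseries (fun k => im ((M ^+ k.+1) i j) / k`!%:R) t) =
          im ((M *m E t) i j).
  apply: cvg_lim => //; apply: cvg_trans cI; apply: near_eq_cvg.
  near=> N; rewrite /pseries /series /= mulmx_sumr summxE im_sum.
  by apply: eq_bigr => k _; rewrite termS imM /=; ring.
exact: is_derive_pseries_fact ler01 rho_ge0 (fun k => im_entry_le k i j).
Unshelve. all: by end_near. Qed.

End MatrixExponential.

(** * The Sylvester differential equation *)

Section SylvesterODE.
Variable R : realType.

Lemma mx_derive_eq (m n : nat) (F : R -> 'M[R[i]]_(m, n)) t D E :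
  mx_derive F t D -> D = E -> mx_derive F t E.
Proof. by move=> dF <-. Qed.

Lemma mx_deriveMl (m n p : nat) (L : 'M[R[i]]_(m, n)) (F : R -> 'M[R[i]]_(n, p)) t D :
  mx_derive F t D -> mx_derive (fun s => L *m F s) t (L *m D).
Proof.
move=> dF; apply: mx_derive_eq (mx_deriveM (mx_derive_cst L t) dF) _.
by rewrite mul0mx add0r.
Qed.

Lemma expmx_inv (n : nat) (M : 'M[R[i]]_n) (t : R) :
  expmx (t%:C *: M) *m expmx (t%:C *: - M) = 1%:M.
Proof.
pose F (s : R) := expmx (s%:C *: M) *m expmx (s%:C *: - M).
have F0 : F 0 = 1%:M by rewrite /F !scale0r expmx0 mulmx1.
rewrite -F0; apply: (@mx_derive0_cst _ _ _ F) => s.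
apply: mx_derive_eq (mx_deriveM (mx_derive_expmx M s) (mx_derive_expmx (- M) s)) _.
by rewrite mulmxA mulmxN mulmx_expmxC mulNmx addrN.
Qed.

(** Variation of constants: [exp(- t C) X(t) exp(- t D)] has derivative zero, so
    it vanishes, and the two exponentials are invertible. *)
Lemma sylvester_ode_uniq (m n : nat) (C : 'M[R[i]]_m) (D : 'M[R[i]]_n)
    (X : R -> 'M[R[i]]_(m, n)) :
  (forall t, mx_derive X t (C *m X t + X t *m D)) -> X 0 = 0 ->
  forall t, X t = 0.
Proof.
move=> dX X0 t.
pose Y (s : R) := expmx (s%:C *: - C) *m X s *m expmx (s%:C *: - D).
have Yt : Y t = 0.
  rewrite (_ : 0 = Y 0); last by rewrite /Y X0 mulmx0 mul0mx.
  apply: (@mx_derive0_cst _ _ _ Y) => s.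
  apply: mx_derive_eq (mx_deriveM (mx_deriveM (mx_derive_expmx (- C) s) (dX s))
    (mx_derive_expmx (- D) s)) _.
  rewrite mulmx_expmxC mulmxDr !(mulmxN, mulNmx) !mulmxA addKr.
  by rewrite addrN.
have expN (k : nat) (M : 'M[R[i]]_k) : expmx (t%:C *: - M) *m expmx (t%:C *: M) = 1%:M.
  by have := expmx_inv (- M) t; rewrite opprK.
have := congr1 (fun Z => expmx (t%:C *: C) *m (Z *m expmx (t%:C *: D))) Yt.
by rewrite /Y -!mulmxA expN mulmx1 mulmxA expmx_inv mul1mx mul0mx mulmx0.
Qed.

Lemma mx_deriveZ (m n : nat) (f : R -> R) (F : R -> 'M[R[i]]_(m, n)) t f' D :
  is_derive (t : R) (1 : R) f (f' : R) -> mx_derive F t D ->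
  mx_derive (fun s => (f s)%:C *: F s) t (f'%:C *: F t + (f t)%:C *: D).
Proof.
move=> df dF i j; have [dR dI] := dF i j; rewrite !mxE reD imD !reM !imM /=.
split.
  under eq_fun do rewrite mxE reM /= mul0r subr0.
  apply: is_derive_eq (is_deriveM df dR) _.
  by rewrite /GRing.scale /=; ring.
under eq_fun do rewrite mxE imM /= mul0r addr0.
apply: is_derive_eq (is_deriveM df dI) _.
by rewrite /GRing.scale /=; ring.
Qed.

Lemma is_derive_fact_pow (j : nat) (t : R) :
  is_derive t 1 (fun s => s ^+ j / j`!%:R)
    (if j is j'.+1 then t ^+ j' / j'`!%:R else 0).
Proof.
have dp := is_deriveM (is_deriveX j (is_derive_id t (1 : R)))
  (is_derive_cst (j`!%:R^-1 : R) t 1).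
rewrite exprfctE in dp.
apply: is_derive_eq dp _; rewrite /GRing.scale /= mulr0 add0r mulr1.
case: j => [|j]; first by rewrite mul0r mulr0.
by rewrite factS natrM; field; rewrite nat1r !pnatr_eq0 -lt0n fact_gt0.
Qed.

Section Transient.
Variables (n p m : nat) (C : 'M[R[i]]_n) (D : 'M[R[i]]_p) (Q : 'M[R[i]]_(n, p)).
Variables (lam : 'I_m -> R[i]) (mu : 'I_m -> nat) (H : 'I_m -> nat -> 'M[R[i]]_n).
Hypothesis chainH : laurent_chain C lam mu H.

Let N i l := mx_negpow ((- lam i)%:M - D) l.
Let E i (t : R) := expmx (t%:C *: ((lam i)%:M + D)).

(** With [N = (- lam i - D)^-1], this is the sum over [1 <= l <= k] of
    [N ^ l * t ^ (k - l) / (k - l)! * exp (t (lam i + D))]. Integration by parts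
    shows that its opposite is an antiderivative of
    [t ^ (k - 1) / (k - 1)! * exp (t (lam i + D))]. *)
Definition transient_weight i k (t : R) : 'M[R[i]]_p :=
  \sum_(1 <= l < k.+1) (t ^+ (k - l) / (k - l)`!%:R)%:C *: (N i l *m E i t).

(** Differentiating [t ^ (k - l) / (k - l)!] lowers [k], and kills the term
    [l = k]; differentiating the exponential multiplies by [lam i + D]. *)
Lemma transient_weight_derive i k t : (0 < k)%N ->
  mx_derive (transient_weight i k) t
    (transient_weight i k.-1 t + transient_weight i k t *m ((lam i)%:M + D)).
Proof.
move=> k0; rewrite /transient_weight.
apply: mx_derive_eq.
  apply: mx_derive_sum => l _; apply: mx_deriveZ; first exact: is_derive_fact_pow.
  exact: mx_deriveMl (mx_derive_expmx _ _).
rewrite big_split /=; congr (_ + _); last first.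
  rewrite mulmx_suml; apply: eq_bigr => l _.
  by rewrite -scalemxAl mulmx_expmxC mulmxA.
rewrite prednK // big_nat_recr //= subnn scale0r addr0.
apply: eq_big_nat => l /andP[_ lk].
by have -> : (k - l = (k.-1 - l).+1)%N by lia.
Qed.

(** The part of the solution that carries the initial condition: it solves the
    homogeneous equation and equals the stationary solution at time 0. *)
Definition transient (t : R) : 'M[R[i]]_(n, p) :=
  \sum_i \sum_(1 <= k < (mu i).+1) H i k *m Q *m transient_weight i k t.

(** Multiplication by [C] raises the index of [H], differentiation lowers that of
    the weight, and the difference telescopes. *)
Lemma transient_derive t :
  mx_derive transient t (C *m transient t + transient t *m D).
Proof.
case: chainH => _ stepH endH.
rewrite /transient mulmx_suml mulmx_sumr -big_split /=.
apply: mx_derive_sum => i _.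
pose T k := transient_weight i k t.
apply: (@mx_derive_eq _ _ _ _ (\sum_(1 <= k < (mu i).+1)
    (H i k *m Q *m (T k.-1 + T k *m ((lam i)%:M + D))))).
  under [X in mx_derive X]eq_fun do rewrite big_nat_cond.
  rewrite big_nat_cond; apply: mx_derive_sum => k /andP[/andP[k0 _] _].
  exact/mx_deriveMl/transient_weight_derive.
rewrite mulmx_suml mulmx_sumr -big_split /=; apply/eqP; rewrite -subr_eq0 -sumrB.
rewrite (eq_big_nat _ _ (F2 := fun k =>
    - (H i k.+1 *m Q *m T k - H i k *m Q *m T k.-1))).
  rewrite sumrN (telescope_sumr (fun k => H i k *m Q *m T k.-1)) //=.
  have T0 : T 0%N = 0 by rewrite /T /transient_weight big_geq.
  by rewrite endH T0 !mul0mx mulmx0 subr0 oppr0.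
move=> k /andP[k0 _]; rewrite !mulmxA stepH // -/(T k).
rewrite !mulmxDr !mulmxDl -!scalemxAl mul_mx_scalar -!scalemxAr !mulmxA.
by rewrite opprB [X in _ - X]addrAC opprD addrA addrK.
Qed.

Lemma transient0 :
  transient 0 = \sum_i \sum_(1 <= k < (mu i).+1) H i k *m Q *m N i k.
Proof.
apply: eq_bigr => i _; apply: eq_big_nat => k /andP[k0 _]; congr (_ *m _).
rewrite /transient_weight big_nat_recr //= big_nat big1 => [|l /andP[_ lk]].
  rewrite subnn fact0 expr0 divr1 scale1r add0r /E.
  by rewrite !(scale0r _) expmx0 mulmx1.
by rewrite expr0n subn_eq0 leqNgt lk mul0r scale0r.
Qed.

End Transient.
End SylvesterODE.

(** * Solutions of the Lyapunov equations *)

Theorem theorem6 (R : realType) (n q m : nat)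
    (A : 'M[R]_n) (B : 'M[R]_(n, q))
    (lambda : 'I_m -> R[i]) (mult : 'I_m -> nat)
    (Pinf : 'M[R]_n) (P : R -> 'M[R]_n) :
  injective lambda ->
  (forall z : R[i], eigenvalue (complex_mx A) z <-> exists i, z = lambda i) ->
  (forall i, mult i = mup (lambda i) (char_poly (complex_mx A))) ->
  (\sum_i mult i)%N = n ->
  (forall i j, lambda i + lambda j != 0) ->
  A *m Pinf + Pinf *m A^T = - (B *m B^T) ->
  (forall t : R, derivable P t 1) ->
  (forall t : R, - derive1 P t + A *m P t + P t *m A^T = - (B *m B^T)) ->
  P 0 = 0 ->
  let AT := (complex_mx A)^T in
  let BBT := complex_mx B *m (complex_mx B)^T in
  let Ahat i k := resolvent_coef (complex_mx A) (lambda i) (mult i) k in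
  let M i k := mx_negpow ((- lambda i)%:M - AT) k in
  [/\ complex_mx Pinf =
        \sum_(i < m) \sum_(1 <= k < (mult i).+1) Ahat i k *m BBT *m M i k,
      forall t : R,
        complex_mx (P t) =
        \sum_(i < m) \sum_(1 <= k < (mult i).+1)
          Ahat i k *m BBT *m
            (M i k -
             \sum_(1 <= l < k.+1)
               (t ^+ (k - l) / (k - l)`!%:R)%:C *:
                 (M i l *m expmx (t%:C *: ((lambda i)%:M + AT))))
    & forall z : R[i], ~~ eigenvalue (complex_mx A) z ->
        resolvent (complex_mx A) z =
        \sum_(i < m) \sum_(1 <= k < (mult i).+1)
          (z - lambda i) ^- k *: Ahat i k].
Proof.
move=> lam_inj eigE multE sum_mult lam_sum Pinf_eq dP P_ode P0.
set C := complex_mx A in eigE multE * => AT BBT Ahat M.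
have chiE := char_poly_prod lam_inj multE sum_mult.
have [H chainH] := laurent_chain_exists lam_inj chiE.
have unit_zC z : (forall i, z != lambda i) -> z%:M - C \in unitmx.
  move=> zlam; apply: unitmx_not_eigenvalue; apply/negP => /eigE[i zi].
  by have := zlam i; rewrite zi eqxx.
have unitD i : (- lambda i)%:M - AT \in unitmx.
  rewrite -[(- lambda i)%:M]tr_scalar_mx -raddfB unitmx_tr.
  by apply: unit_zC => j; rewrite eq_sym -subr_eq0 opprK addrC.
have AhatE i k : (0 < k <= mult i)%N -> Ahat i k = H i k.
  exact: resolvent_coef_chain.
pose S := \sum_i \sum_(1 <= k < (mult i).+1) H i k *m BBT *m M i k.
have S_eq : C *m S + S *m AT = - BBT by exact: lyapunov_chain.
have complex_BBT : complex_mx (B *m B^T) = BBT by rewrite /complex_mx map_mxM -map_trmx.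
have complex_lyap X : complex_mx (A *m X + X *m A^T) =
    C *m complex_mx X + complex_mx X *m AT.
  by rewrite /complex_mx map_mxD !map_mxM -map_trmx.
split.
- transitivity S; last first.
    apply: eq_bigr => i _; apply: eq_big_nat => k k_mult.
    by rewrite AhatE.
  apply/eqP; rewrite -subr_eq0; apply/eqP.
  apply: (sylvester_uniq chiE unitD); rewrite mulmxBr mulmxBl addrACA -opprD.
  by rewrite S_eq -complex_lyap Pinf_eq -complex_BBT /complex_mx map_mxN subrr.
- move=> t; pose G := transient AT BBT lambda mult H.
  transitivity (S - G t); last first.
    rewrite -sumrB; apply: eq_bigr => i _; rewrite -sumrB; apply: eq_big_nat => k k_mult.
    by rewrite AhatE // mulmxBr.
  (* The solution minus the claimed one, which vanishes at time 0. *)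
  pose X s := complex_mx (P s) - S + G s.
  suff /eqP : X t = 0.
    by rewrite /X -addrA [- S + _]addrC -opprB subr_eq0 => /eqP.
  apply: (@sylvester_ode_uniq _ _ _ C AT X); last first.
    by rewrite /X P0 /G transient0 -/S /complex_mx map_mx0 sub0r addNr.
  move=> s; apply: mx_derive_eq.
    apply: mx_deriveD (transient_derive _ _ chainH s).
    exact: mx_deriveD (mx_derive_complex (dP s)) (mx_derive_cst _ _).
  have -> : derive1 P s = A *m P s + P s *m A^T + B *m B^T.
    by rewrite -[B *m _]opprK -(P_ode s) -[X in _ - X]addrA opprD opprK [RHS]addrCA addrN addr0.
  rewrite addr0 /X -/(G s) mulmxDr mulmxDl mulmxBr mulmxBl.
  rewrite /complex_mx map_mxD -!/(complex_mx _) complex_lyap complex_BBT.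
  rewrite [RHS]addrACA; congr (_ + _).
  by rewrite [RHS]addrACA -opprD S_eq opprK.
- move=> z zN; rewrite (resolvent_chain chainH); last exact: unitmx_not_eigenvalue.
    apply: eq_bigr => i _; apply: eq_big_nat => k k_mult.
    by rewrite AhatE.
  move=> i; apply: contra zN => /eqP zi; apply/eigE; by exists i.
Qed.
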